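(* For every finite, simple, $d$-regular digraph $D$ with $d\ge 1$, and for every positive integer $k$ satisfying $$k\le\frac{\sqrt[d]{e d^2}}{\sqrt[d]{e d^2}-1},$$ there exists a directed cycle in $D$ whose length is divisible by $k$.
   Context: A $d$-regular digraph is a (nonempty) directed graph in which the in-degree and the out-degree of every vertex are equal to $d$. Simple means no loops and no parallel arcs (two arcs with the same tail and same head). $e$ is the base of the natural logarithm. *)

(* Defs.v *)
From mathcomp Require Import all_boot.

Set Implicit Arguments.
Unset Strict Implicit.
Unset Printing Implicit Defensive.

(* A digraph on the finite vertex type V is its arc relation, [arc x y] being
   the arc from x to y. This excludes parallel arcs; opposite arcs x -> y and
   y -> x are allowed. Loops are excluded by [loopless]. *)

Definition loopless (V : finType) (arc : rel V) : Prop := irreflexive arc.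

Definition outdeg (V : finType) (arc : rel V) (x : V) : nat :=
  #|[set y | arc x y]|.

Definition indeg (V : finType) (arc : rel V) (x : V) : nat :=
  #|[set y | arc y x]|.

Definition regular_digraph (V : finType) (arc : rel V) (d : nat) : Prop :=
  (0 < #|V|)%N /\ forall x : V, indeg arc x = d /\ outdeg arc x = d.

(* [ucycle] also accepts the empty sequence, whose length 0 is divisible by
   every k, so nonemptiness is required. Since c has distinct vertices,
   [size c] is the number of arcs of the cycle. *)
Definition directed_cycle (V : finType) (arc : rel V) (c : seq V) : Prop :=
  (0 < size c)%N /\ ucycle arc c.

(* Main.v *)
(* Colour the vertices by Z/k uniformly at random and call v bad if no
   out-neighbour y of v has f y = f v + 1. If no vertex is bad, following such
   out-neighbours ends in a cycle along which the colour increases by 1 at each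
   step, so its length is divisible by k (Alon and Linial). A vertex is bad with
   probability p = (1 - 1/k)^d, and the hypothesis says e * d^2 * p <= 1.
   The event "v is bad" is independent of the colours outside the d
   out-neighbours of v, so it depends on at most d^2 other bad events. The
   symmetric local lemma would require e * (d^2 + 1) * p <= 1. The missing slack
   comes from the d(d - 1) events of vertices sharing an out-neighbour with v:
   they fall into d groups, one for each out-neighbour y of v. A conditioning
   set that misses all in-neighbours of y gives the better conditional bound
   r = 1/d^2, and a union bound inside the group costs 1 - (d - 1) r instead of
   a product of d - 1 factors. *)

Require Import Defs.
From HB Require Import structures.
From mathcomp Require Import all_boot all_order all_algebra.
From mathcomp Require Import ring lra zify.

Set Implicit Arguments.
Unset Strict Implicit.
Unset Printing Implicit Defensive.

Import Order.TTheory GRing.Theory Num.Theory.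
Local Open Scope ring_scope.

(** * Cycles along which a colour increases by one *)

Section CyclesFromMaps.

Lemma iter_periodic_point (V : finType) (g : V -> V) (x0 : V) :
  exists x m, iter m.+1 g x = x.
Proof.
have /trajectP[i lt_i_o loop] := looping_order g x0.
exists (iter i g x0), (order g x0 - i.+1)%N.
by rewrite -iterD -subSn // subSS subnK // ltnW.
Qed.

Lemma cycle_of_colouring (V : finType) (arc : rel V) (m : nat)
    (f : V -> 'I_m.+1) (g : V -> V) (x0 : V) :
  (forall x, arc x (g x)) -> (forall x, f (g x) = f x + inord 1) ->
  exists c : seq V, directed_cycle arc c /\ (m.+1 %| size c)%N.
Proof.
move=> arcg fg; have [x [m0 xper]] := iter_periodic_point g x0.
exists (orbit g x); split.
  split; first by rewrite size_orbit order_gt0.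
  rewrite /ucycle orbit_uniq andbT.
  apply: sub_cycle (all_iffLR orbitPcycle 3%N 0%N (ex_intro _ m0 xper)).
  by move=> y _ /eqP <-.
rewrite size_orbit.
have iterf n : f (iter n g x) = f x + (inord 1) *+ n.
  elim: n => [|n IHn]; first by rewrite mulr0n addr0.
  by rewrite iterS fg IHn mulrSr addrA.
move: (iterf (order g x)); rewrite (all_iffLR orbitPcycle 3%N 4%N (ex_intro _ m0 xper)).
rewrite -[LHS]addr0 => /addrI/(congr1 val) /=.
rewrite Zp_mulrn /=.
(* For [m = 0] the colour [inord 1] is 0 and carries no information, but 1 divides every length. *)
case: m {f fg iterf} => [|m]; first by rewrite dvd1n.
by rewrite inordK // mul1n => /esym/eqP.
Qed.

End CyclesFromMaps.

(** * Independence by counting colourings *)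

Section Recolouring.
Variables (V : finType) (m : nat).
Local Notation colouring := {ffun V -> 'I_m.+1}.

(** A shift rather than an overwriting, so that it is a bijection on colourings. *)
Definition recolour (w : V) (j : 'I_m.+1) (f : colouring) : colouring :=
  [ffun x => if x == w then f x + j else f x].

Lemma recolourK w j : cancel (recolour w j) (recolour w (- j)).
Proof.
by move=> f; apply/ffunP => x; rewrite !ffunE; case: eqP => // _; rewrite addrK.
Qed.

(** Shifting the colour of [w] permutes the [m.+1] classes of constant [f w - c f] inside [Q], so
    they have equal size; avoidance excludes one of them. *)
Lemma card_avoid_one (Q : pred colouring) (c : colouring -> 'I_m.+1) (w : V) :
  (forall j f, Q (recolour w j f) = Q f) ->
  (forall j f, c (recolour w j f) = c f) ->
  (m.+1 * #|[set f | Q f & f w != c f]| = m * #|[set f | Q f]|)%N.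
Proof.
move=> Qinv cinv.
pose E (j : 'I_m.+1) := [set f | Q f & f w - c f == j].
have cardE j : #|E j| = #|E 0%R|.
  rewrite -(card_imset _ (can_inj (recolourK w (- j)))); apply: eq_card => f.
  apply/imsetP/idP => [[h]|].
    rewrite !inE => /andP[Qh /eqP hj] ->.
    by rewrite Qinv Qh cinv ffunE eqxx addrAC hj subrr eqxx.
  rewrite !inE => /andP[Qf /eqP f0]; exists (recolour w j f).
    by rewrite inE Qinv Qf cinv ffunE eqxx addrAC f0 add0r eqxx.
  by rewrite recolourK.
have cardQ : #|[set f | Q f]| = (m.+1 * #|E 0%R|)%N.
  rewrite -sum1_card (partition_big (fun f : colouring => f w - c f) xpredT) //=.
  rewrite -[X in (X * _)%N](card_ord m.+1) -sum_nat_const; apply: eq_bigr => j _.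
  rewrite -(cardE j) -sum1_card; apply: eq_bigl => f.
  by rewrite !inE.
have -> : #|[set f | Q f & f w != c f]| = (m * #|E 0%R|)%N.
  apply/eqP; rewrite -(eqn_add2l #|E 0%R|) -mulSn -cardQ; apply/eqP.
  rewrite -(cardsID [set f : colouring | f w == c f] [set f | Q f]).
  by congr (_ + _)%N; apply: eq_card => f; rewrite !inE ?subr_eq0 // andbC.
by rewrite cardQ mulnCA.
Qed.

(** Product rule: [W] has no repetitions, so recolouring one of its vertices leaves the constraints
    at the others unchanged. *)
Lemma card_avoid (Q : pred colouring) (c : colouring -> 'I_m.+1) (W : seq V) :
  uniq W ->
  (forall w, w \in W -> forall j f, Q (recolour w j f) = Q f) ->
  (forall w, w \in W -> forall j f, c (recolour w j f) = c f) ->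
  (m.+1 ^ size W * #|[set f | Q f & all (fun w => f w != c f) W]|
     = m ^ size W * #|[set f | Q f]|)%N.
Proof.
elim: W => [|w W IHW] /=.
  by move=> _ _ _; congr (_ * _)%N; apply: eq_card => f; rewrite !inE andbT.
case/andP=> wW uW Qinv cinv.
pose Q' f := Q f && all (fun w => f w != c f) W.
have {}IHW : (m.+1 ^ size W * #|[set f | Q' f]| = m ^ size W * #|[set f | Q f]|)%N.
  by apply: IHW => // u uW'; [apply: Qinv | apply: cinv]; rewrite inE uW' orbT.
have winv j f : Q' (recolour w j f) = Q' f.
  rewrite /Q' Qinv ?mem_head //; congr (_ && _); apply: eq_in_all => u uW'.
  rewrite cinv ?mem_head // ffunE; case: (eqVneq u w) => // uw.
  by move: wW; rewrite -uw uW'.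
have := card_avoid_one winv (cinv w (mem_head w W)).
set A := #|[set f | Q' f & _]| => eA.
have -> : #|[set f | Q f & (f w != c f) && all (fun w => f w != c f) W]| = A.
  by apply: eq_card => f; rewrite !inE /Q' -andbA [in RHS](andbC (all _ _)).
by rewrite !expnS -mulnA mulnCA eA mulnCA IHW mulnA.
Qed.

End Recolouring.

Lemma finset_ind (T : finType) (P : {set T} -> Prop) :
  P set0 -> (forall x (A : {set T}), x \notin A -> P A -> P (x |: A)) ->
  forall A, P A.
Proof.
move=> P0 PU A; have [n] := ubnP #|A|; elim: n A => // n IHn A ltA.
have [->//|[x xA]] := set_0Vmem A.
rewrite -(setD1K xA); apply: PU; first by rewrite setD11.
by apply: IHn; rewrite (cardsD1 x) xA in ltA.
Qed.

(** * The local lemma for bad vertices *)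

Section LocalLemma.
Variables (R : realFieldType) (V : finType) (arc : rel V) (d m : nat).
Hypothesis loopfree : irreflexive arc.
Hypothesis degreed : forall x, indeg arc x = d /\ outdeg arc x = d.
Local Notation colouring := {ffun V -> 'I_m.+1}.
Local Notation out v := [set y | arc v y].
Local Notation inn y := [set u | arc u y].

Definition good (f : colouring) (u : V) : bool :=
  [exists y, arc u y && (f y == f u + inord 1)].

Definition goodset (T : {set V}) : {set colouring} :=
  [set f : colouring | [forall u in T, good f u]].

(** Unnormalised probability: a conditional bound x on the badness of [v] reads
    [cnt T - cnt (v |: T) <= x * cnt T], which avoids dividing by a count that might be zero. *)
Definition cnt (T : {set V}) : R := #|goodset T|%:R.

Lemma goodsetU1 v T : goodset (v |: T) = [set f in goodset T | good f v].
Proof.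
apply/setP => f; rewrite !inE; apply/forall_inP/andP.
  move=> gf; split; last by apply: gf; rewrite setU11.
  by apply/forall_inP => u uT; apply: gf; rewrite setU1r.
by case=> /forall_inP gf gv u /setU1P[-> //|]; apply: gf.
Qed.

Lemma cnt_ge0 T : 0 <= cnt T. Proof. exact: ler0n. Qed.

Lemma cntU1 v T :
  cnt T - cnt (v |: T) = #|[set f in goodset T | ~~ good f v]|%:R.
Proof.
apply/eqP; rewrite subr_eq addrC -natrD goodsetU1 /cnt; apply/eqP; congr _%:R.
rewrite -(cardsID [set f | good f v] (goodset T)).
by congr (_ + _)%N; apply: eq_card => f; rewrite !inE // andbC.
Qed.

Lemma good_recolour w j f u :
  u != w -> ~~ arc u w -> good (recolour w j f) u = good f u.
Proof.
move=> uw auw; apply: eq_existsb => y; rewrite !ffunE (negPf uw).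
by case: (eqVneq y w) => // ->; rewrite (negPf auw).
Qed.

(** Goodness on [T] ignores the colours of the out-neighbours of [v], and so does [f v] by
    looplessness; [v] is bad when these [d] colours all avoid [f v + inord 1]. *)
Lemma cnt_bad_far v (T : {set V}) :
  (forall u, u \in T -> ~~ arc v u) ->
  (forall u y, u \in T -> arc v y -> ~~ arc u y) ->
  cnt T - cnt (v |: T) = (m%:R / m.+1%:R) ^+ d * cnt T.
Proof.
move=> nadj ncop; rewrite cntU1.
pose Q f := [forall u in T, good f u].
have inv w : w \in enum (out v) -> forall j (f : colouring),
    Q (recolour w j f) = Q f /\ recolour w j f v + inord 1 = f v + inord 1.
  rewrite mem_enum inE => avw j f; split.
    apply: eq_forallb => u; case uT : (u \in T) => //=.
    apply: good_recolour; last exact: ncop.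
    by apply: contraNneq (nadj _ uT) => ->.
  by rewrite ffunE; case: eqP => // vw; rewrite vw loopfree in avw.
have := @card_avoid _ _ Q (fun f => f v + inord 1) _ (enum_uniq (out v))
  (fun w wv j f => (inv w wv j f).1) (fun w wv j f => (inv w wv j f).2).
rewrite -cardE.
have -> : #|[set y | arc v y]| = d by exact: (degreed v).2.
have -> : [set f | Q f & all (fun w => f w != f v + inord 1) (enum (out v))]
        = [set f in goodset T | ~~ good f v].
  apply/setP => f; rewrite !inE; congr (_ && _).
  rewrite negb_exists; apply/allP/forallP => h y.
    rewrite negb_and -implybE; apply/implyP => avy.
    by apply: h; rewrite mem_enum inE.
  by rewrite mem_enum inE => avy; have := h y; rewrite avy.
move/(congr1 (fun n => n%:R : R)); rewrite !natrM !natrX => e.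
have n0 : (m.+1%:R : R) ^+ d != 0 by rewrite expf_neq0 // pnatr_eq0.
by apply: (mulfI n0); rewrite e expr_div_n mulrA mulrCA divff // mulr1.
Qed.

Lemma goodsetS (T1 T2 : {set V}) : T1 \subset T2 -> goodset T2 \subset goodset T1.
Proof.
move=> sT; apply/subsetP => f; rewrite !inE => /forall_inP gf.
by apply/forall_inP => u uT; apply: gf; apply: (subsetP sT).
Qed.

Lemma cnt_bad_mono v (T1 T2 : {set V}) : T1 \subset T2 ->
  cnt T2 - cnt (v |: T2) <= cnt T1 - cnt (v |: T1).
Proof.
move=> sT; rewrite !cntU1 ler_nat subset_leq_card //.
apply/subsetP => f; rewrite !in_set => /andP[gf ->]; rewrite andbT.
by have := subsetP (goodsetS sT) f; rewrite !inE; apply.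
Qed.

(** The costs add up because [cnt_bad_mono] lets every bad event be counted against [T] alone. *)
Lemma cnt_union_bound (T C : {set V}) (r : R) :
  (forall u, u \in C -> cnt T - cnt (u |: T) <= r * cnt T) ->
  cnt T - cnt (C :|: T) <= (#|C|%:R * r) * cnt T.
Proof.
elim/finset_ind: C => [|v C vC IHC] ub.
  by rewrite set0U cards0 !mul0r subrr.
have {}IHC := IHC (fun u uC => ub u (setU1r v uC)).
rewrite cardsU1 vC -setUA natrD !mulrDl mul1r.
have := cnt_bad_mono v (subsetUr C T); have := ub v (setU11 v C); lra.
Qed.

(** Chain rule, adding the vertices of [C] one at a time. Asking the bound only for proper subsets
    [C'] lets an induction on cardinality supply it. *)
Lemma cnt_chain (T C : {set V}) (x : R) : 0 <= x <= 1 ->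
  (forall v (C' : {set V}), v \in C -> v \notin C' :|: T -> C' \proper C ->
     cnt (C' :|: T) - cnt (v |: (C' :|: T)) <= x * cnt (C' :|: T)) ->
  (1 - x) ^+ #|C| * cnt T <= cnt (C :|: T).
Proof.
move=> /andP[x0 x1]; elim/finset_ind: C => [|v C vC IHC] ub.
  by rewrite set0U cards0 expr0 mul1r.
have {}IHC : (1 - x) ^+ #|C| * cnt T <= cnt (C :|: T).
  apply: IHC => u C' uC nu pC; apply: ub => //; first exact: setU1r.
  exact: proper_sub_trans pC (subsetUr _ _).
rewrite cardsU1 vC exprS -mulrA -setUA.
have x1' : 0 <= 1 - x by rewrite subr_ge0.
apply: le_trans (ler_wpM2l x1' IHC) _.
have [vT|vT] := boolP (v \in C :|: T).
  have -> : v |: (C :|: T) = C :|: T by apply/setUidPr; rewrite sub1set.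
  by rewrite ler_piMl ?cnt_ge0 // gerBl.
have := ub v C (setU11 v C) vT; rewrite properUr ?sub1set // => /(_ isT); lra.
Qed.

(* [r] bounds the conditional probability of a bad event given that the
   vertices of [T] are good, when [T] misses all in-neighbours of some
   out-neighbour of the vertex; [r / s] bounds it in general. *)
Variable r : R.
Local Notation s := (1 - (d%:R - 1) * r).
Local Notation p := ((m%:R / m.+1%:R) ^+ d : R).
Hypothesis r_ge0 : 0 <= r.
Hypothesis dr_lt1 : d%:R * r < 1.
Hypothesis d_gt0 : (0 < d)%N.
Hypothesis p_le : p * s <= r * (1 - d%:R * r) ^+ d.

Let s_gt0 : 0 < s.
Proof. by move: dr_lt1 r_ge0; rewrite mulrBl; lra. Qed.

Let oneBx : 1 - r / s = (1 - d%:R * r) / s.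
Proof. by have /lt0r_neq0 := s_gt0 => ?; field. Qed.

Let x_itv : 0 <= r / s <= 1.
Proof.
rewrite divr_ge0 ?(ltW s_gt0) //= -subr_ge0 oneBx divr_ge0 ?(ltW s_gt0) //.
by rewrite subr_ge0 ltW.
Qed.

Let trim (T : {set V}) (Y : seq V) := [set u in T | ~~ has (arc u) Y].

(** Putting back the in-neighbours of one [y] costs a factor [s]: there are at most [d - 1] of them,
    since [v] is an in-neighbour of [y] outside [T], and the set they join misses [inn y], so the
    bound [r] applies to each. *)
Lemma local_lemma_step n :
  (forall (T : {set V}) v y, (#|T| < n)%N -> v \notin T -> arc v y ->
     [disjoint T & inn y] -> cnt T - cnt (v |: T) <= r * cnt T) ->
  forall (T : {set V}) v (Y : seq V), (#|T| <= n)%N -> v \notin T ->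
    all (arc v) Y ->
    s ^+ size Y * cnt (trim T Y) <= cnt T.
Proof.
move=> IHb T v + leT vT; elim=> [_|y Y IHY /= /andP[avy aY]].
  rewrite expr0 mul1r (_ : trim T [::] = T) //.
  by apply/setP => u; rewrite inE andbT.
rewrite exprSr -mulrA; apply: le_trans (IHY aY).
apply: ler_wpM2l; first by rewrite exprn_ge0 // ltW.
set T' := trim T (y :: Y); pose C := trim T Y :&: inn y.
have eT : trim T Y = C :|: T'.
  apply/setP => u; rewrite !inE /= negb_or.
  by case: (u \in T); case: (arc u y); case: (has _ _).
have cardC : (#|C| <= d.-1)%N.
  rewrite -ltnS prednK // -(degreed y).1 /indeg.
  apply: proper_card; apply/properP; split; first exact: subsetIr.
  by exists v; rewrite !inE ?(negPf vT).
have ub u : u \in C -> cnt T' - cnt (u |: T') <= r * cnt T'.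
  rewrite !inE => /andP[/andP[uT uY] auy]; apply: (IHb _ _ y) => //.
  - apply: leq_trans leT; apply: proper_card; apply/properP; split.
      by apply/subsetP => w; rewrite inE => /andP[].
    by exists u => //; rewrite inE uT /= auy.
  - by rewrite inE uT /= auy.
  - rewrite disjoint_subset; apply/subsetP => w.
    by rewrite !inE /= => /andP[_]; rewrite negb_or => /andP[].
have := cnt_union_bound ub; rewrite -eT.
have : #|C|%:R * r * cnt T' <= (d%:R - 1) * r * cnt T'.
  rewrite ler_wpM2r ?cnt_ge0 // ler_wpM2r // lerBrDr natr1 ler_nat.
  by rewrite -(prednK d_gt0) ltnS.
lra.
Qed.

(** Both bounds are proved together by induction on the size of [T]. Removing the groups of [Y] and
    then the out-neighbours of [v] bounds the conditional probability by p / (s^|Y| (1 - r/s)^d). As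
    1 - r/s = (1 - d r)/s, [p_le] makes this at most [r / s] for |Y| = d and at most [r] for |Y| = d
    - 1. *)
Lemma local_lemma n :
  (forall (T : {set V}) v, (#|T| < n)%N -> v \notin T ->
     cnt T - cnt (v |: T) <= r / s * cnt T) /\
  (forall (T : {set V}) v y, (#|T| < n)%N -> v \notin T -> arc v y ->
     [disjoint T & inn y] -> cnt T - cnt (v |: T) <= r * cnt T).
Proof.
elim: n => [//|n [IHa IHb]].
have step := local_lemma_step IHb.
(* The last premise ensures that no vertex of [trim T Y] shares an out-neighbour with [v]. *)
have key (T : {set V}) v (Y : seq V) : (#|T| <= n)%N -> v \notin T ->
    all (arc v) Y ->
    (forall u y, u \in T -> arc v y -> arc u y -> has (arc u) Y) ->
    s ^+ size Y * (1 - r / s) ^+ d * (cnt T - cnt (v |: T)) <= p * cnt T.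
  move=> leT vT aY hY.
  pose T2 := trim T Y :\: out v; pose C := trim T Y :&: out v.
  have subT : trim T Y \subset T by apply/subsetP => u; rewrite inE => /andP[].
  have sT2 : T2 \subset T := subset_trans (subsetDl _ _) subT.
  have eT : C :|: T2 = trim T Y.
    by apply: setID.
  have far : cnt T2 - cnt (v |: T2) = p * cnt T2.
    apply: cnt_bad_far => [u|u y]; rewrite !inE => /andP[nvu /andP[uT uY]] //.
    by move=> avy; apply: contra uY; apply: hY.
  have := cnt_bad_mono v sT2; rewrite far => le_bad.
  have oneBx_ge0 : 0 <= 1 - r / s by have /andP[] := x_itv; rewrite subr_ge0.
  have cardC : (#|C| <= d)%N.
    by rewrite -[X in (_ <= X)%N](degreed v).2 subset_leq_card ?subsetIr.
  have chain : (1 - r / s) ^+ d * cnt T2 <= cnt (trim T Y).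
    rewrite -eT; apply: le_trans (cnt_chain x_itv _).
      rewrite ler_wpM2r ?cnt_ge0 // ler_wiXn2l //.
      by rewrite gerBl; have /andP[] := x_itv.
    move=> u C' _ nu pC; apply: IHa => //; apply: leq_trans leT.
    apply: proper_card; apply: proper_sub_trans subT.
    have [sC [z zC zC']] := properP pC.
    rewrite -eT; apply/properP; split; first exact: setSU.
    exists z; first by rewrite inE zC.
    by move: zC; rewrite !inE negb_or zC' => /andP[_ ->].
  have sY_ge0 : 0 <= s ^+ size Y by rewrite exprn_ge0 // ltW.
  have p_ge0 : 0 <= p by rewrite exprn_ge0 // divr_ge0.
  have low := le_trans (ler_wpM2l sY_ge0 chain) (step T v Y leT vT aY).
  apply: le_trans (ler_wpM2l p_ge0 low).
  have := ler_wpM2l (mulr_ge0 sY_ge0 (exprn_ge0 d oneBx_ge0)) le_bad; lra.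
have sn0 : s != 0 by rewrite gt_eqF.
have q_gt0 : 0 < (1 - d%:R * r) ^+ d by rewrite exprn_gt0 // subr_gt0.
have p_le' : p <= r / s * (1 - d%:R * r) ^+ d.
  by rewrite mulrAC ler_pdivlMr.
split=> [T v|T v y] leT vT.
  have aout : all (arc v) (enum (out v)).
    by apply/allP => y; rewrite mem_enum inE.
  have := key T v _ leT vT aout.
  rewrite -cardE -/(outdeg arc v) (degreed v).2 -exprMn oneBx.
  rewrite [s * _]mulrC divfK // => le_p.
  rewrite -(ler_pM2l q_gt0); apply: le_trans (le_p _) _.
    move=> u y uT avy auy; apply/hasP; exists y => //.
    by rewrite mem_enum inE.
  by rewrite [leRHS]mulrCA mulrA ler_wpM2r ?cnt_ge0 // mulrC.
move=> avy dis.
(* No vertex of [T] has an arc to [y], so [y] can be left out of [Y], saving one factor [s]. *)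
have aout : all (arc v) (enum (out v :\ y)).
  by apply/allP => z; rewrite mem_enum !inE => /andP[].
have := key T v _ leT vT aout; rewrite -cardE.
have -> : #|out v :\ y| = d.-1.
  by rewrite -[in RHS](degreed v).2 /outdeg [in RHS](cardsD1 y) inE avy.
have -> : s ^+ d.-1 * (1 - r / s) ^+ d = (1 - d%:R * r) ^+ d / s.
  rewrite oneBx expr_div_n -[X in _ / s ^+ X](prednK d_gt0) exprS.
  rewrite mulrCA; congr (_ * _).
  by rewrite invfM mulrCA mulfV ?mulr1 ?expf_neq0.
move=> le_p.
rewrite -(ler_pM2l (divr_gt0 q_gt0 s_gt0)); apply: le_trans (le_p _) _.
  move=> u z uT avz auz; apply/hasP; exists z => //.
  rewrite mem_enum !inE avz andbT; apply: contraTneq auz => ->.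
  by move/disjointFr: dis => /(_ _ uT); rewrite inE => ->.
rewrite [leRHS]mulrA ler_wpM2r ?cnt_ge0 //.
by rewrite [leRHS]mulrC [leRHS]mulrCA [leRHS]mulrC.
Qed.

(** The chain rule from the empty set to all vertices keeps a positive fraction of the colourings,
    since [1 - r / s] is positive. *)
Lemma exists_good_colouring : exists f : colouring, forall u, good f u.
Proof.
have [IHa _] := local_lemma #|V|.+1.
have : 0 < cnt setT.
  rewrite -[setT]setU0; apply: lt_le_trans (cnt_chain x_itv _); last first.
    by move=> v C' _ vC _; apply: IHa; rewrite // ltnS max_card.
  apply: mulr_gt0.
    by rewrite exprn_gt0 // oneBx divr_gt0 // subr_gt0.
  rewrite ltr0n; apply/card_gt0P; exists [ffun=> 0].
  by rewrite inE; apply/forall_inP => u; rewrite inE.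
rewrite ltr0n => /card_gt0P[f]; rewrite inE => /forall_inP gf.
by exists f => u; apply: gf.
Qed.

End LocalLemma.

(* Only imported here because all_classical shadows the names of finset. *)
From mathcomp Require Import all_classical all_reals all_analysis.

(** * Numerical estimates *)

Section Numerics.
Variable R : realType.

Lemma expR1_gt2 : 2 < expR 1 :> R.
Proof. by have := expR_gt1Dx (oner_neq0 R); lra. Qed.

(** With a the [d]-th root of e d^2, a > 1 turns the hypothesis into a m <= m + 1; then take [d]-th
    powers. *)
Lemma expR_mul_pow_le (d m : nat) : (0 < d)%N ->
  m.+1%:R <= ((expR 1 * d%:R ^+ 2) `^ (d%:R^-1)) /
    ((expR 1 * d%:R ^+ 2) `^ (d%:R^-1) - 1) :> R ->
  expR 1 * d%:R ^+ 2 * m%:R ^+ d <= m.+1%:R ^+ d :> R.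
Proof.
move=> d0; have d1 : 1 <= d%:R :> R by rewrite ler1n.
set b := expR 1 * _; set a := b `^ _ => hb.
have b1 : 1 < b by have := expR1_gt2; rewrite /b; nra.
have b0 : 0 <= b by apply: ltW; apply: lt_trans b1.
have ad : a ^+ d = b.
  rewrite -powR_mulrn ?powR_ge0 // -powRrM mulVf ?powRr1 //.
  by rewrite pnatr_eq0 -lt0n.
have a1 : 1 < a.
  rewrite ltNge; apply/negP => a1.
  by have := exprn_ile1 d (powR_ge0 _ _) a1; rewrite ad leNgt b1.
move: hb; rewrite ler_pdivlMr ?subr_gt0 // -natr1 => hb.
have am : a * m%:R <= m%:R + 1 by lra.
rewrite -ad -exprMn; rewrite lerXn2r //; first by rewrite nnegrE mulr_ge0 // powR_ge0.
by rewrite natr1 nnegrE.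
Qed.

(** From m + 1 <= 2 m one gets 2 d^2 < e d^2 <= 2^d, which fails for d = 1, ..., 6. *)
Lemma degree_ge7 (d m : nat) : (0 < d)%N -> (0 < m)%N ->
  expR 1 * d%:R ^+ 2 * m%:R ^+ d <= m.+1%:R ^+ d :> R -> (7 <= d)%N.
Proof.
move=> d0 m0 hb.
have md : 0 < (m%:R : R) ^+ d by rewrite exprn_gt0 // ltr0n.
have : expR 1 * d%:R ^+ 2 * m%:R ^+ d <= 2 ^+ d * m%:R ^+ d :> R.
  apply: (le_trans hb); rewrite -exprMn; rewrite lerXn2r ?nnegrE ?mulr_ge0 //.
  by rewrite -natrM ler_nat; lia.
rewrite ler_pM2r // => hd.
have : ((2 * d ^ 2)%:R : R) < (2 ^ d)%:R.
  rewrite natrM !natrX; apply: lt_le_trans hd.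
  by rewrite ltr_pM2r ?exprn_gt0 ?ltr0n // expR1_gt2.
rewrite ltr_nat; move: d0 {hb md hd}.
by case: d => [|[|[|[|[|[|[|d]]]]]]].
Qed.

(* The second-order term of [ln (1 - t)] is [- t ^ 2 / 2]; the constant [6/7]
   absorbs the higher order terms for [t <= 1/7] and still gives
   [1 - 6/7 t >= 1 - t + t ^ 2]. *)
Lemma expR1_pow_ge (d : nat) (t : R) : (7 <= d)%N -> t = d%:R^-1 ->
  1 - t + t ^+ 2 <= expR 1 * (1 - t) ^+ d.
Proof.
move=> d7 td; have d0 : 0 < d%:R :> R by rewrite ltr0n; lia.
have dt : d%:R * t = 1 by rewrite td mulfV // gt_eqF.
have t0 : 0 < t by rewrite td invr_gt0.
have t7 : t <= 1 / 7.
  rewrite td div1r lef_pV2 ?posrE //.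
  by rewrite ler_nat.
pose z := t + 6 / 7 * t ^+ 2.
have z_ge : expR (- z) <= 1 - t.
  rewrite expRN -div1r ler_pdivrMr ?expR_gt0 //.
  (* The bound 1 + z is too weak here: it leaves the coefficient 6/7 - 1 at t^2. Squaring adds 1/4
     and makes it 3/28. *)
  have : (1 + z / 2) ^+ 2 <= expR z.
    have -> : expR z = expR (z / 2) ^+ 2.
      by rewrite expr2 -expRD -splitr.
    rewrite ler_sqr ?nnegrE ?expR_ge0 ?expR_ge1Dx //.
    by rewrite /z; nra.
  have : 1 <= (1 - t) * (1 + z / 2) ^+ 2.
    have -> : (1 - t) * (1 + z / 2) ^+ 2 = 1 + t ^+ 2 / 196 *
        (21 - 133 * t - 48 * t ^+ 2 - 36 * t ^+ 3).
      by rewrite /z; field.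
    have : t ^+ 2 <= 1 / 49 by nra.
    have : t ^+ 3 <= 1 / 343 by rewrite exprS; nra.
    have : 0 <= t ^+ 2 by nra.
    by nra.
  have : 0 < 1 - t by lra.
  by nra.
have : expR (- z) ^+ d <= (1 - t) ^+ d.
  by rewrite lerXn2r ?nnegrE ?expR_ge0 //; lra.
rewrite -expRM_natl.
have -> : d%:R * (- z) = - 1 - 6 / 7 * t.
  rewrite /z; ring: dt.
move/(ler_wpM2l (expR_ge0 1)); rewrite -expRD; apply: le_trans.
rewrite addrA subrr sub0r; apply: le_trans (expR_ge1Dx _).
by nra.
Qed.

Lemma local_lemma_weight (d m : nat) : (0 < d)%N ->
  expR 1 * d%:R ^+ 2 * m%:R ^+ d <= m.+1%:R ^+ d :> R ->
  exists r : R, [/\ 0 <= r, d%:R * r < 1 &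
    (m%:R / m.+1%:R) ^+ d * (1 - (d%:R - 1) * r) <= r * (1 - d%:R * r) ^+ d].
Proof.
move=> d0 hb; have [m0|m0] := posnP m.
  (* With a single colour p = 0, so the weight 0 works. *)
  by exists 0; rewrite m0 mul0r expr0n eqn0Ngt d0 /= !mulr0 !mul0r.
have d7 := degree_ge7 d0 m0 hb; pose t : R := d%:R^-1.
have dpos : 0 < d%:R :> R by rewrite ltr0n.
have dt : d%:R * t = 1 by rewrite mulfV // gt_eqF.
have t0 : 0 < t by rewrite invr_gt0.
have t1 : t < 1 by rewrite invf_lt1 // ltr1n; lia.
have et : d%:R * t ^+ 2 = t by rewrite expr2 mulrA dt mul1r.
(* For r = 1/d^2 one has d r = t and s = 1 - t + t^2; since p <= t^2 / e, what remains is s <= e (1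
   - t)^d. *)
exists (t ^+ 2); split; rewrite ?et //; first exact: exprn_ge0 (ltW t0).
rewrite (_ : 1 - _ = 1 - t + t ^+ 2); last by rewrite -{2}et; ring.
have le_s := expR1_pow_ge d7 (erefl t).
have e0 := expR_gt0 (1 : R).
have p_le : (m%:R / m.+1%:R) ^+ d <= t ^+ 2 / expR 1 :> R.
  rewrite expr_div_n ler_pdivrMr ?exprn_gt0 ?ltr0n // mulrAC.
  rewrite ler_pdivlMr // exprVn mulrC -ler_pdivrMl ?invr_gt0 ?exprn_gt0 //.
  by rewrite invrK mulrCA mulrA.
have s_ge0 : 0 <= 1 - t + t ^+ 2 by nra.
apply: le_trans (ler_wpM2r s_ge0 p_le) _.
rewrite -mulrA ler_wpM2l ?exprn_ge0 ?(ltW t0) //.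
by rewrite ler_pdivrMl.
Qed.

End Numerics.

Theorem corollary7 (R : realType) (V : finType) (arc : rel V) (d k : nat)
    (hd : (1 <= d)%N) (hk : (1 <= k)%N)
    (hsimple : loopless arc) (hreg : regular_digraph arc d)
    (hbound : k%:R <=
      ((expR 1 * d%:R ^+ 2) `^ (d%:R^-1)) /
      ((expR 1 * d%:R ^+ 2) `^ (d%:R^-1) - 1) :> R) :
  exists c : seq V, directed_cycle arc c /\ (k %| size c)%N.
Proof.
case: k hk hbound => // m _ hbound; have [/card_gt0P[x0 _] degd] := hreg.
have [r [r0 dr1 pr]] := local_lemma_weight hd (expR_mul_pow_le hd hbound).
have [f gf] := exists_good_colouring hsimple degd r0 dr1 hd pr.
pose g x := xchoose (existsP (gf x)).
have gP x := andP (xchooseP (existsP (gf x))).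
by apply: (@cycle_of_colouring _ _ _ f g x0) => x; have [? /eqP] := gP x.
Qed.
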